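(* Let $r$ be the rank of the kernel $\mathcal K$ and let $\pi_r=u\,\Omega_r$, where $u$ is the all-ones row vector. Then $\pi_r$ is supported on the range classes of the kernel, and the corresponding distribution, obtained by normalizing $\pi_r$ to have total weight one, is precisely the measure $\beta$ on the range classes.
   Context: The setting: a directed graph on the vertex set $\{1,\ldots,n\}$ in which each vertex has out-degree $d$, with adjacency matrix $\mathcal A$ such that $A=d^{-1}\mathcal A$ is irreducible and aperiodic; $\mathcal A=C_1+\cdots+C_d$, where each $C_i$ is a binary stochastic matrix (a $0$-$1$ matrix with exactly one $1$ in each row). $\mathcal S$ is the finite semigroup generated by the $C_i$ under matrix multiplication, and $\mathcal K$ is its kernel (minimal ideal, consisting of the elements of minimal rank $r$). Each binary stochastic matrix $F$ corresponds to the function $f$ with $F_{ij}=1$ iff $f(i)=j$; $F^{(\ell)}$ is the matrix indexed by the $\ell$-element subsets $I,J$ of the vertex set with $F^{(\ell)}_{IJ}=1$ if $f(I)=J$ and $0$ otherwise. Let $A_r=\frac1d\sum_iC_i^{(r)}$ and $\Omega_r=\lim_{N\to\infty}\frac1N\sum_{m=1}^NA_r^m$ (which exists). Let $\mu^{(1)}(w)=\#\{i:C_i=w\}/d$ for $w\in\mathcal S$, $\mu^{(m)}$ its $m$-th convolution power, and $\lambda(w)=\lim_{N\to\infty}\frac1N\sum_{m=1}^N\mu^{(m)}(w)$, known to exist and to be a probability measure with support $\mathcal K$ which factors as $\lambda=\alpha\times\omega\times\beta$ along the Rees product decomposition $\mathcal K\cong\mathcal X\times\mathcal G\times\mathcal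 Y$, where $\mathcal X$ is identified with the set of partitions and $\mathcal Y$ with the set of range classes of elements of $\mathcal K$, and $\omega$ is uniform on the group $\mathcal G$. A range class is the range (an $r$-element set of vertices, the labels of the nonzero columns) of some $k\in\mathcal K$; the partition of $k$ is the partition of the vertices into the preimages $\{i:k_{ij}=1\}$ of the points $j$ of its range. Thus $\beta(R)=\lambda(\{k\in\mathcal K:\text{range of }k=R\})$ and $\alpha(P)=\lambda(\{k\in\mathcal K:\text{partition of }k=P\})$. *)

(* Defs.v *)
From HB Require Import structures.
From mathcomp Require Import all_boot all_order all_algebra.
From mathcomp Require Import all_classical all_reals all_analysis.

Set Implicit Arguments.
Unset Strict Implicit.
Unset Printing Implicit Defensive.
Import Order.TTheory GRing.Theory Num.Theory.
Import numFieldNormedType.Exports.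
Local Open Scope ring_scope.

Definition binary_stochastic n (F : 'M[nat]_n) : bool :=
  [forall i, forall j, (F i j <= 1)%N] &&
  [forall i, #|[set j | F i j == 1%N]| == 1%N].

Record bsmx n := BSMx { bsval :> 'M[nat]_n; bsvalP : binary_stochastic bsval }.

HB.instance Definition _ n := [isSub for @bsval n].
HB.instance Definition _ n := [Choice of bsmx n by <:].

(* [bsfun F i] is the unique [j] with [F i j = 1]; the default is never used. *)
Definition bsfun n (F : bsmx n) (i : 'I_n) : 'I_n :=
  odflt i [pick j | F i j == 1%N].

Definition funmx n (f : {ffun 'I_n -> 'I_n}) : 'M[nat]_n :=
  \matrix_(i, j) (f i == j : nat).

Lemma funmx_subproof n (f : {ffun 'I_n -> 'I_n}) : binary_stochastic (funmx f).
Proof.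
apply/andP; split.
  by apply/forallP => i; apply/forallP => j; rewrite mxE leq_b1.
apply/forallP => i; apply/cards1P; exists (f i); apply/setP => j.
by rewrite !inE mxE (eq_sym j); case: (f i == j).
Qed.

Definition bs_of_fun n f : bsmx n := BSMx (funmx_subproof f).

Lemma bsvalE n (F : bsmx n) i j : F i j = (bsfun F i == j).
Proof.
have /andP[/forallP/(_ i)/forallP F01 /forallP/(_ i)/cards1P[k Fk]] := bsvalP F.
have Fi l : (F i l == 1%N) = (l == k) by move/setP: Fk => /(_ l); rewrite !inE.
have -> : bsfun F i = k.
  by rewrite /bsfun; case: pickP => [l|/(_ k)]; rewrite Fi ?eqxx // => /eqP.
rewrite eq_sym -Fi; have := F01 j.
by case: (F i j) => [|[|m]].
Qed.

Lemma bsfunK n :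
  cancel (fun F : bsmx n => finfun (bsfun F)) (@bs_of_fun n).
Proof.
by move=> F; apply/val_inj/matrixP => i j; rewrite mxE ffunE bsvalE.
Qed.

HB.instance Definition _ n := [Countable of bsmx n by <:].
HB.instance Definition _ n := fintype.isFinite.Build (bsmx n) (pcan_enumP (can_pcan (@bsfunK n))).

Lemma bsmul_subproof n (F G : bsmx n) : binary_stochastic (F *m G).
Proof.
suff -> : F *m G = funmx [ffun i => bsfun G (bsfun F i)] by exact: funmx_subproof.
apply/matrixP => i j; rewrite !mxE (bigD1 (bsfun F i)) //= big1 => [|k].
  by rewrite addr0 !bsvalE ffunE eqxx mul1r.
by rewrite bsvalE eq_sym => /negPf->; rewrite mul0r.
Qed.

Definition bsmul n (F G : bsmx n) : bsmx n := BSMx (bsmul_subproof F G).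

Definition natmx (R : pzSemiRingType) m n (F : 'M[nat]_(m, n)) : 'M[R]_(m, n) :=
  map_mx (fun k => k%:R) F.

Definition irreducible_mx (R : numDomainType) n (A : 'M[R]_n) : Prop :=
  forall i j, exists2 m, (0 < m)%N & 0 < (A ^+ m) i j.

(* The greatest common divisor of the return times of every state is 1. *)
Definition aperiodic_mx (R : numDomainType) n (A : 'M[R]_n) : Prop :=
  forall (i : 'I_n) (p : nat),
    (forall m, (0 < m)%N -> 0 < (A ^+ m) i i -> (p %| m)%N) -> p = 1%N.

Definition subsemigroup n (T : {set bsmx n}) : bool :=
  [forall F in T, forall G in T, bsmul F G \in T].

Definition gen_semigroup n d (C : 'I_d -> bsmx n) : {set bsmx n} :=
  \bigcap_(T : {set bsmx n} | subsemigroup T && [forall i, C i \in T]) T.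

Definition ideal n (S I : {set bsmx n}) : bool :=
  [&& I != finset.set0, I \subset S &
      [forall F in S, forall G in I, (bsmul F G \in I) && (bsmul G F \in I)]].

Definition is_kernel n (S K : {set bsmx n}) : bool := minset (ideal S) K.

Definition mxrange n (F : bsmx n) : {set 'I_n} :=
  [set j | [exists i, F i j != 0%N]].

Definition range_classes n (K : {set bsmx n}) : {set {set 'I_n}} :=
  [set mxrange k | k in K].

Definition ksubsets n (l : nat) : {set {set 'I_n}} := [set I : {set 'I_n} | #|I| == l].

(* Matrices indexed by the [l]-subsets are indexed through this enumeration. *)
Definition ksubset n l (a : 'I_#|ksubsets n l|) : {set 'I_n} := enum_val a.

Definition subset_mx (R : pzSemiRingType) n l (F : bsmx n) :
    'M[R]_#|ksubsets n l| :=
  \matrix_(a, b) (bsfun F @: ksubset a == ksubset b)%:R.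

Definition A_level (R : fieldType) n d (C : 'I_d -> bsmx n) l :
    'M[R]_#|ksubsets n l| :=
  d%:R^-1 *: \sum_i subset_mx R l (C i).

(* The limit is taken entry by entry. *)
Definition Omega_level (R : realType) n d (C : 'I_d -> bsmx n) l :
    'M[R]_#|ksubsets n l| :=
  \matrix_(a, b)
    limn (fun N : nat =>
      (N%:R^-1 *: \sum_(1 <= m < N.+1) A_level R C l ^+ m) a b).

Definition pi_level (R : realType) n d (C : 'I_d -> bsmx n) l :
    'rV[R]_#|ksubsets n l| :=
  const_mx 1 *m Omega_level R C l.

(* Measures on the semigroup are extended by 0 to all binary stochastic matrices. *)
Definition convolution (R : pzSemiRingType) n (p q : bsmx n -> R) : bsmx n -> R :=
  fun w => \sum_u \sum_(v | bsmul u v == w) p u * q v.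

(* Only meaningful for [0 < m]. *)
Definition conv_power (R : pzSemiRingType) n (p : bsmx n -> R) (m : nat) :
    bsmx n -> R :=
  iter m.-1 (convolution p) p.

Definition mu1 (R : fieldType) n d (C : 'I_d -> bsmx n) : bsmx n -> R :=
  fun w => #|[set i | C i == w]|%:R / d%:R.

Definition lambda (R : realType) n d (C : 'I_d -> bsmx n) : bsmx n -> R :=
  fun w => limn (fun N : nat =>
    N%:R^-1 * \sum_(1 <= m < N.+1) conv_power (mu1 R C) m w).

Definition beta (R : realType) n d (C : 'I_d -> bsmx n) (K : {set bsmx n})
    (S : {set 'I_n}) : R :=
  \sum_(k in K | mxrange k == S) lambda R C k.

(* Main.v *)
Require Import Defs.
From mathcomp Require Import all_boot all_order all_algebra.
From mathcomp Require Import all_classical all_reals all_analysis.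
From mathcomp Require Import lra.

Set Implicit Arguments.
Unset Strict Implicit.
Unset Printing Implicit Defensive.
Import Order.TTheory GRing.Theory Num.Theory.
Import numFieldNormedType.Exports.
Local Open Scope ring_scope.

(** Let [lambda] be the Cesàro limit of the convolution powers of [mu1]. Since
    [F |-> subset_mx F] is multiplicative, [A_level ^+ m] for [0 < m] is the
    combination of the [subset_mx w] with weights [conv_power m w], hence
    [Omega_level] is the combination with weights [lambda w]
    ([Omega_level_comb]). The limit exists
    by the mean ergodic theorem, applied to the stochastic matrix of left
    multiplication by a random generator ([cesaro_power_cvg], [lambda_cvg]).

    [lambda] is a probability, equals its convolution with [mu1] on the left,
    and vanishes off the kernel [K] ([lambda_ideal]): the random left
    multiplications never leave [K], so by stationarity none of the mass outside
    [K] can enter it, although some product of generators sends the whole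
    semigroup into [K].

    All elements of [K] have range of size [r], and the product of two of them
    is again in [K]; therefore each [k] in [K] maps every range class onto the
    range of [k] ([imset_range_class]). Consequently a row of [Omega_level]
    indexed by a range class is exactly [beta]. Now [Omega_level] is idempotent
    ([Omega_level_idem]), so [pi_r = pi_r *m Omega_level]; as [pi_r] lives on
    the range classes, this reads [pi_r = total * beta]. *)

(** * Cesàro means of powers of a matrix *)

Lemma cvg_cesaro_bounded (R : realType) (x : nat -> R) (M : R) :
  (forall N, `|x N| <= M) ->
  ((fun N : nat => N%:R^-1 * x N) @ \oo --> (0 : R))%classic.
Proof.
move=> xM; apply/cvgr0Pnorm_le => e e_gt0.
have M_ge0 : 0 <= M by exact: le_trans (xM 0%N).
near=> N.
have N_gt0 : 0 < N%:R :> R by rewrite ltr0n; near: N; exists 1%N.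
rewrite normrM normfV (ger0_norm (ler0n _ _)) ler_pdivrMl //.
apply: le_trans (xM N) _; rewrite -ler_pdivrMr //; near: N.
exact: nbhs_infty_ger.
Unshelve. all: by end_near.
Qed.

Lemma cvg_sumr (R : realType) (I : finType) (f : I -> nat -> R) (l : I -> R) :
  (forall i, (f i @ \oo --> l i)%classic) ->
  ((fun N => \sum_i f i N) @ \oo --> \sum_i l i)%classic.
Proof.
move=> fl; apply: cvg_big => [|i _]; last exact: fl.
exact: (@add_continuous R).
Qed.

Definition power_bounded (R : realType) n (B : 'M[R]_n) :=
  exists M : R, forall k i j, `|(B ^+ k) i j| <= M.

Lemma power_bounded_sum (R : realType) m n (B : 'M[R]_n) (Z : 'M[R]_(m, n)) i j :
  power_bounded B ->
  exists M, forall k, `|(Z *m (B ^+ k - 1)) i j| <= M.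
Proof.
case=> M BM; exists (\sum_l `|Z i l| * (M + `|(1 : 'M[R]_n) l j|)) => k.
rewrite mxE; apply: le_trans (ler_norm_sum _ _ _) _; apply: ler_sum => l _.
rewrite normrM ler_wpM2l // !mxE; apply: le_trans (ler_normB _ _) _.
by rewrite lerD2r.
Qed.

Lemma mulmx_geometric (R : realType) m n (B : 'M[R]_n) (Z : 'M[R]_(m, n)) N :
  Z *m (B - 1) *m (\sum_(k < N) B ^+ k) = Z *m (B ^+ N - 1).
Proof. by rewrite -mulmxA -[_ *m \sum_(_ < _) _]subrX1. Qed.

Lemma mulmx_geometric_fixed (R : realType) m n (B : 'M[R]_n)
    (Y : 'M[R]_(m, n)) N :
  Y *m (B - 1) = 0 -> Y *m (\sum_(k < N) B ^+ k) = N%:R *: Y.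
Proof.
rewrite mulmxBr mulmx1 => /eqP; rewrite subr_eq0 => /eqP YB.
rewrite mulmx_sumr (eq_bigr (fun=> Y)) => [|k _].
  by rewrite sumr_const card_ord scaler_nat.
elim: (k : nat) => [|l IHl]; first by rewrite expr0 mulmx1.
by rewrite exprS mulmxA YB.
Qed.

(** Rows [X = Z *m (B - 1)] that are fixed by [B] satisfy
    [N *: X = X *m \sum_(k < N) B ^+ k = Z *m (B ^+ N - 1)], which stays bounded
    in [N]; hence they are zero. *)
Lemma fixed_image_disjoint (R : realType) n (B : 'M[R]_n) :
  power_bounded B -> (kermx (B - 1) :&: (B - 1))%MS = 0.
Proof.
move=> Bbd; set X := (_ :&: _)%MS.
have X0 : X *m (B - 1) = 0 by apply/sub_kermxP; exact: capmxSl.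
have /submxP[Z XZ] : (X <= B - 1)%MS by exact: capmxSr.
apply/matrixP => i j; rewrite [RHS]mxE.
have [M ZM] := power_bounded_sum Z i j Bbd.
have cv0 := cvg_cesaro_bounded ZM.
apply: (@cvg_unique _ _ _ _ _ _ _ cv0); first exact: norm_hausdorff.
apply: cvg_near_cst; near=> N.
have N_gt0 : 0 < N%:R :> R by rewrite ltr0n; near: N; exists 1%N.
rewrite -mulmx_geometric -XZ mulmx_geometric_fixed // mxE mulKf //.
exact: lt0r_neq0.
Unshelve. all: by end_near.
Qed.

(** Mean ergodic theorem. Fixed rows and the image of [B - 1] are in direct sum,
    and by rank they span everything, so [1 = Y + Z *m (B - 1)] with [Y] fixed by
    [B]. The Cesàro means of the first part equal [Y], those of the second part
    telescope and tend to zero; the limit is [Y]. *)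
Lemma cesaro_power_cvg (R : realType) n (B : 'M[R]_n) i j :
  power_bounded B ->
  exists l : R,
    ((fun N : nat => N%:R^-1 * \sum_(k < N) (B ^+ k) i j) @ \oo --> l)%classic.
Proof.
move=> Bbd.
have full : (1%:M <= kermx (B - 1) + (B - 1)%R)%MS.
  rewrite sub1mx /row_full mxrank_disjoint_sum ?fixed_image_disjoint //.
  by rewrite mxrank_ker subnK ?rank_leq_row.
have /sub_addsmxP[[U Z] /= UZ] := full; set Y := U *m _ in UZ.
have Y0 : Y *m (B - 1) = 0 by rewrite -mulmxA mulmx_ker mulmx0.
have [M ZM] := power_bounded_sum Z i j Bbd.
exists (Y i j + 0).
apply: cvg_trans (cvgD (cvg_cst (Y i j)) (cvg_cesaro_bounded ZM)).
apply: near_eq_cvg; near=> N.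
have N_gt0 : 0 < N%:R :> R by rewrite ltr0n; near: N; exists 1%N.
have sumE : \sum_(k < N) B ^+ k = N%:R *: Y + Z *m (B ^+ N - 1).
  rewrite -[LHS]mul1mx UZ mulmxDl (mulmx_geometric_fixed _ Y0).
  by rewrite mulmx_geometric.
have sumEij : (\sum_(k < N) B ^+ k) i j = N%:R * Y i j + (Z *m (B ^+ N - 1)) i j.
  by rewrite sumE mxE [X in X + _]mxE.
by rewrite /= -summxE sumEij mulrDr mulKf // lt0r_neq0.
Unshelve. all: by end_near.
Qed.

(** * Ranges, ranks and the action on subsets *)

Lemma bsfun_mul n (F G : bsmx n) i : bsfun (bsmul F G) i = bsfun G (bsfun F i).
Proof.
have := bsvalE (bsmul F G) i (bsfun G (bsfun F i)).
rewrite /= mxE (bigD1 (bsfun F i)) //= big1 => [|k].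
  by rewrite addr0 !bsvalE !eqxx mulr1; case: eqP.
by rewrite bsvalE eq_sym => /negPf->; rewrite mul0r.
Qed.

Lemma bsmx_inj n (F G : bsmx n) : bsfun F =1 bsfun G -> F = G.
Proof. by move=> FG; apply/val_inj/matrixP => i j; rewrite !bsvalE FG. Qed.

Lemma bsmulA n : associative (@bsmul n).
Proof. by move=> F G H; apply: bsmx_inj => i; rewrite !bsfun_mul. Qed.

Lemma imset_bsmul n (F G : bsmx n) (I : {set 'I_n}) :
  bsfun (bsmul F G) @: I = bsfun G @: (bsfun F @: I).
Proof. by rewrite -imset_comp; apply: eq_imset => i; rewrite bsfun_mul. Qed.

Lemma mxrangeE n (F : bsmx n) : mxrange F = bsfun F @: finset.setT.
Proof.
apply/setP => j; rewrite inE; apply/existsP/imsetP => [[i]|[i _ ->]].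
  by rewrite bsvalE eqb0 negbK => /eqP <-; exists i; rewrite ?inE.
by exists i; rewrite bsvalE eqxx.
Qed.

Lemma imset_sub_mxrange n (F : bsmx n) (I : {set 'I_n}) :
  bsfun F @: I \subset mxrange F.
Proof. by rewrite mxrangeE imsetS // finset.subsetT. Qed.

Lemma mxrange_mul n (F G : bsmx n) : mxrange (bsmul F G) = bsfun G @: mxrange F.
Proof. by rewrite !mxrangeE imset_bsmul. Qed.

(** [natmx R F] has the same row space as the matrix [B] of the indicator rows of
    the points of its range: each row of [F] is a row of [B], and a section of
    [bsfun F] recovers [B] from rows of [F]. The rows of [B] are free. *)
Lemma rank_natmx (R : fieldType) n (F : bsmx n) :
  \rank (natmx R F) = #|mxrange F|.
Proof.
set S := mxrange F.
pose B : 'M[R]_(#|S|, n) := \matrix_(a, j) (enum_val a == j)%:R.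
have FS i : bsfun F i \in S by rewrite /S mxrangeE imset_f ?inE.
have FB : natmx R F = \matrix_(i, a) (bsfun F i == enum_val a)%:R *m B.
  apply/matrixP => i j; rewrite !mxE bsvalE.
  rewrite (bigD1 (enum_rank_in (FS i) (bsfun F i))) //= big1 => [|a neq].
    by rewrite addr0 !mxE enum_rankK_in // eqxx mul1r.
  rewrite !mxE; case: eqP => [Fia|_]; last by rewrite mul0r.
  by case/eqP: neq; apply: enum_val_inj; rewrite enum_rankK_in.
have preim (a : 'I_#|S|) : {i | bsfun F i == enum_val a}.
  apply: sigW; have := enum_valP a.
  by rewrite {2}/S mxrangeE => /imsetP[i _ ->]; exists i.
have BF : B = (\matrix_(a, i) (sval (preim a) == i)%:R) *m natmx R F.
  apply/matrixP => a j; rewrite !mxE (bigD1 (sval (preim a))) //= big1 => [|i].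
    by rewrite addr0 !mxE eqxx mul1r bsvalE (eqP (svalP (preim a))).
  by rewrite !mxE eq_sym => /negPf->; rewrite mul0r.
have B_free : B *m B^T = 1%:M.
  apply/matrixP => a b; rewrite !mxE (bigD1 (enum_val a)) //= big1 => [|j].
    by rewrite addr0 !mxE eqxx mul1r (inj_eq enum_val_inj) eq_sym.
  by rewrite !mxE eq_sym => /negPf->; rewrite mul0r.
have rkB : \rank B = #|S| by apply/eqP/row_freeP; exists B^T.
apply/eqP; rewrite -[X in _ == X]rkB eqn_leq; apply/andP; split; apply: mxrankS.
  by rewrite FB submxMl.
by rewrite BF submxMl.
Qed.

(** The sum over intermediate subsets has a nonzero term only if [F] is injective
    on the subset; otherwise [bsmul F G] shrinks it as well and both sides
    vanish. *)
Lemma subset_mxM (R : pzSemiRingType) n l (F G : bsmx n) :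
  subset_mx R l (bsmul F G) = subset_mx R l F *m subset_mx R l G.
Proof.
apply/matrixP => a b; rewrite !mxE imset_bsmul.
have cardE (c : 'I_#|ksubsets n l|) : #|ksubset c| = l.
  by have := enum_valP c; rewrite inE => /eqP.
have [/eqP Il|Il] := boolP (#|bsfun F @: ksubset a| == l).
  have Iin : bsfun F @: ksubset a \in ksubsets n l by rewrite inE Il.
  rewrite (bigD1 (enum_rank_in Iin (bsfun F @: ksubset a))) //=.
  rewrite big1 => [|c neq].
    by rewrite addr0 !mxE /ksubset enum_rankK_in // eqxx mul1r.
  rewrite !mxE; case: eqP => [Fa|_]; last by rewrite mul0r.
  by case/eqP: neq; apply: enum_val_inj; rewrite enum_rankK_in // Fa.
rewrite big1 => [|c _].
  case: eqP => // Gb; case/negP: Il; rewrite eqn_leq; apply/andP; split.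
    by apply: leq_trans (leq_imset_card _ _) _; rewrite cardE.
  apply: (@leq_trans #|ksubset b|); first by rewrite cardE.
  by rewrite -Gb leq_imset_card.
rewrite !mxE; case: eqP => [Fa|_]; last by rewrite mul0r.
by rewrite Fa cardE eqxx in Il.
Qed.

(** * Convolution powers of a distribution *)

Definition distribution (R : numDomainType) n (p : bsmx n -> R) :=
  (forall w, 0 <= p w) /\ \sum_w p w = 1.

(** Integration against a convolution; [V] is the ring itself for expectations of
    functions, and a space of matrices for averages of [subset_mx]. *)
Lemma sum_convolution (R : comPzRingType) n (V : lmodType R) (p q : bsmx n -> R)
    (F : bsmx n -> V) :
  \sum_w convolution p q w *: F w =
  \sum_u \sum_v (p u * q v) *: F (bsmul u v).
Proof.
under eq_bigr do rewrite scaler_suml.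
rewrite exchange_big; apply: eq_bigr => u _ /=.
under eq_bigr do rewrite big_mkcond scaler_suml.
rewrite exchange_big; apply: eq_bigr => v _ /=.
rewrite (bigD1 (bsmul u v)) //= eqxx big1 ?addr0 // => w.
by rewrite eq_sym => /negPf->; rewrite scale0r.
Qed.

Lemma convolution_distribution (R : numDomainType) n (p q : bsmx n -> R) :
  distribution p -> distribution q -> distribution (convolution p q).
Proof.
move=> [p0 p1] [q0 q1]; split=> [w|].
  by apply: sumr_ge0 => u _; apply: sumr_ge0 => v _; rewrite mulr_ge0.
have := @sum_convolution R n R^o p q (fun=> 1).
under eq_bigr do rewrite [_ *: _]mulr1; move=> ->.
under eq_bigr => u _.
  under eq_bigr do rewrite [_ *: _]mulr1.
  rewrite -mulr_sumr q1 mulr1; over.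
exact: p1.
Qed.

Lemma conv_powerSS (R : pzSemiRingType) n (p : bsmx n -> R) m w :
  conv_power p m.+2 w = convolution p (conv_power p m.+1) w.
Proof. by []. Qed.

Lemma conv_power_distribution (R : numDomainType) n (p : bsmx n -> R) m :
  distribution p -> distribution (conv_power p m.+1).
Proof. by move=> pd; elim: m => // m IHm; apply: convolution_distribution. Qed.

Lemma distribution_le1 (R : numDomainType) n (p : bsmx n -> R) w :
  distribution p -> p w <= 1.
Proof. by case=> p0 <-; rewrite (bigD1 w) //= lerDl sumr_ge0. Qed.

(** Transition matrix of the walk on [bsmx n] that multiplies the current state on
    the left by an element drawn from [p]: convolution by [p] in coordinates. *)
Definition lmul_mx (R : pzSemiRingType) n (p : bsmx n -> R) :
    'M[R]_#|{: bsmx n}| :=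
  \matrix_(a, b) \sum_(u | bsmul u (enum_val a) == enum_val b) p u.

Lemma sum_lmul_mx (R : numDomainType) n (p : bsmx n -> R) a :
  distribution p -> \sum_b lmul_mx p a b = 1.
Proof.
move=> [_ <-]; under eq_bigr do rewrite mxE big_mkcond.
rewrite exchange_big; apply: eq_bigr => u _ /=.
rewrite (bigD1 (enum_rank (bsmul u (enum_val a)))) //= enum_rankK eqxx.
rewrite big1 ?addr0 // => b neq; case: eqP => // ub.
by rewrite ub enum_valK eqxx in neq.
Qed.

Lemma lmul_mx_power_bounded (R : realType) n (p : bsmx n -> R) :
  distribution p -> power_bounded (lmul_mx p).
Proof.
move=> pd; have [p0 _] := pd; exists 1.
have L0 a b : 0 <= lmul_mx p a b by rewrite mxE sumr_ge0.
suff Pk k a : (forall b, 0 <= (lmul_mx p ^+ k) a b) /\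
              \sum_b (lmul_mx p ^+ k) a b = 1.
  move=> k a b; have [P0 P1] := Pk k a; rewrite ger0_norm //.
  by rewrite -P1 (bigD1 b) //= lerDl sumr_ge0.
elim: k a => [|k IHk] a.
  rewrite expr0; split=> [b|]; first by rewrite mxE ler0n.
  rewrite (bigD1 a) //= big1 => [|b]; first by rewrite mxE eqxx addr0.
  by rewrite mxE eq_sym => /negPf->.
rewrite exprS; split=> [b|].
  rewrite mxE; apply: sumr_ge0 => c _; rewrite mulr_ge0 //.
  by case: (IHk c).
under eq_bigr do rewrite mxE.
rewrite exchange_big -(sum_lmul_mx a pd); apply: eq_bigr => c _ /=.
by rewrite -mulr_sumr (IHk c).2 mulr1.
Qed.

Lemma conv_power_lmul_mx (R : comPzRingType) n (p : bsmx n -> R) m w :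
  conv_power p m.+1 w =
  \sum_a p (enum_val a) * (lmul_mx p ^+ m) a (enum_rank w).
Proof.
elim: m w => [|m IHm] w.
  rewrite (bigD1 (enum_rank w)) //= big1 => [|a].
    by rewrite addr0 enum_rankK mxE eqxx mulr1.
  by rewrite mxE => /negPf->; rewrite mulr0.
rewrite conv_powerSS /convolution.
under eq_bigr do rewrite big_mkcond.
rewrite exchange_big (reindex _ (onW_bij _ (enum_val_bij (bsmx n)))) /=.
under [RHS]eq_bigr do rewrite exprSr mxE mulr_sumr.
rewrite [RHS]exchange_big; apply: eq_bigr => b _ /=.
under [RHS]eq_bigr do rewrite mulrA.
rewrite -mulr_suml mxE enum_rankK -big_mkcond /= -mulr_suml mulrC; congr (_ * _).
by rewrite IHm; apply: eq_bigr => a _; rewrite enum_valK.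
Qed.

(** * The Cesàro limit [lambda] *)

Definition cesaro (R : realType) n (p : bsmx n -> R) (N : nat) (w : bsmx n) : R :=
  N%:R^-1 * \sum_(1 <= m < N.+1) conv_power p m w.

Lemma cesaroE (R : realType) n (p : bsmx n -> R) N w :
  cesaro p N w = N%:R^-1 * \sum_(m < N) conv_power p m.+1 w.
Proof. by rewrite /cesaro big_add1 big_mkord. Qed.

(** The convolution powers are the rows [p *m lmul_mx p ^+ m] of a power bounded
    matrix, so their means are finite combinations of convergent ones. *)
Lemma cesaro_cvg (R : realType) n (p : bsmx n -> R) w :
  distribution p -> exists l : R, ((fun N => cesaro p N w) @ \oo --> l)%classic.
Proof.
move=> pd; have Bbd := lmul_mx_power_bounded pd.
have /choice[l lP] := fun a => cesaro_power_cvg a (enum_rank w) Bbd.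
exists (\sum_a p (enum_val a) * l a).
rewrite (@eq_cvg _ _ _ _ (fun N => \sum_a p (enum_val a) *
  (N%:R^-1 * \sum_(k < N) (lmul_mx p ^+ k) a (enum_rank w)))) => [|N].
  by apply: cvg_sumr => a; apply: cvgMl_tmp.
rewrite cesaroE; under eq_bigr do rewrite conv_power_lmul_mx.
rewrite exchange_big mulr_sumr; apply: eq_bigr => a _ /=.
by rewrite -mulr_sumr mulrCA.
Qed.

Lemma cesaro_distribution (R : realType) n (p : bsmx n -> R) N :
  distribution p -> distribution (cesaro p N.+1).
Proof.
move=> pd; split=> [w|].
  rewrite cesaroE mulr_ge0 ?invr_ge0 //; apply: sumr_ge0 => m _.
  by case: (conv_power_distribution m pd).
under eq_bigr do rewrite cesaroE.
rewrite -mulr_sumr exchange_big (eq_bigr (fun=> 1)) => [|m _].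
  by rewrite sumr_const card_ord mulVf // pnatr_eq0.
by case: (conv_power_distribution m pd).
Qed.

(** Convolving shifts the summation window by one, so only the two end terms
    survive. *)
Lemma convolution_cesaro (R : realType) n (p : bsmx n -> R) N w :
  convolution p (cesaro p N) w =
  cesaro p N w + N%:R^-1 * (conv_power p N.+1 w - p w).
Proof.
rewrite !cesaroE -mulrDr -[p w]/(conv_power p 1 w).
rewrite -(telescope_sumr (fun m => conv_power p m w)) // big_add1 big_mkord.
rewrite -big_split /=; under [in RHS]eq_bigr do rewrite addrC subrK.
rewrite mulr_sumr /convolution.
under [RHS]eq_bigr do rewrite conv_powerSS /convolution mulr_sumr.
rewrite [RHS]exchange_big; apply: eq_bigr => u _ /=.
under [RHS]eq_bigr do rewrite mulr_sumr.
rewrite [RHS]exchange_big; apply: eq_bigr => v _ /=.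
by rewrite cesaroE mulrCA !mulr_sumr.
Qed.

Lemma mu1_distribution (R : realType) n d (C : 'I_d -> bsmx n) :
  (0 < d)%N -> distribution (mu1 R C).
Proof.
move=> d_gt0; split=> [w|]; first by rewrite /mu1 divr_ge0.
rewrite /mu1 -mulr_suml -natr_sum.
have -> : (\sum_w #|[set i | C i == w]| = d)%N; last first.
  by rewrite divff // pnatr_eq0 -lt0n.
rewrite -[RHS](card_ord d) -sum1_card (partition_big C predT) //=.
by apply: eq_bigr => w _; rewrite -sum1_card; apply: eq_bigl => i; rewrite inE.
Qed.

Lemma sum_mu1 (R : fieldType) n d (C : 'I_d -> bsmx n) (V : lmodType R)
    (F : bsmx n -> V) :
  \sum_w mu1 R C w *: F w = d%:R^-1 *: \sum_i F (C i).
Proof.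
rewrite [in RHS](partition_big C predT) //= scaler_sumr.
apply: eq_bigr => w _; rewrite /mu1 mulrC -scalerA; congr (_ *: _).
rewrite (eq_bigr (fun=> F w)) => [|i /eqP -> //].
rewrite sumr_const scaler_nat; congr (_ *+ _).
by apply: eq_card => i; rewrite inE.
Qed.

Lemma lambda_cvg (R : realType) n d (C : 'I_d -> bsmx n) w :
  (0 < d)%N -> ((fun N => cesaro (mu1 R C) N w) @ \oo --> lambda R C w)%classic.
Proof.
move=> d_gt0; have [l lP] := cesaro_cvg w (mu1_distribution R C d_gt0).
by rewrite /lambda (cvg_lim _ lP).
Qed.

Lemma lambda_distribution (R : realType) n d (C : 'I_d -> bsmx n) :
  (0 < d)%N -> distribution (lambda R C).
Proof.
move=> d_gt0; have mud := mu1_distribution R C d_gt0; split=> [w|].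
  have cvw := @lambda_cvg R n d C w d_gt0.
  rewrite -(cvg_lim _ cvw) //; apply: limr_ge.
    by apply/cvg_ex; eexists; exact: cvw.
  by exists 1%N => // -[//|N] _; case: (cesaro_distribution N mud).
have cvS := cvg_sumr (fun w => @lambda_cvg R n d C w d_gt0).
apply: (@cvg_unique _ _ _ _ _ _ cvS); first exact: norm_hausdorff.
apply: cvg_near_cst; exists 1%N => // -[//|N] _.
by case: (cesaro_distribution N mud).
Qed.

(** Pass to the limit in [convolution_cesaro]: the end terms are bounded and are
    divided by [N]. *)
Lemma lambda_stationary (R : realType) n d (C : 'I_d -> bsmx n) w :
  (0 < d)%N -> convolution (mu1 R C) (lambda R C) w = lambda R C w.
Proof.
move=> d_gt0; have mud := mu1_distribution R C d_gt0.
have cvL : ((fun N => convolution (mu1 R C) (cesaro (mu1 R C) N) w) @ \oo -->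
            convolution (mu1 R C) (lambda R C) w)%classic.
  rewrite /convolution; apply: cvg_sumr => u; under eq_cvg do rewrite big_mkcond.
  rewrite big_mkcond; apply: cvg_sumr => v; case: ifP => _; last exact: cvg_cst.
  by apply: cvgMl_tmp; exact: lambda_cvg.
apply: (@cvg_unique _ _ _ _ _ _ cvL); first exact: norm_hausdorff.
rewrite /mkset; under eq_cvg do rewrite convolution_cesaro.
rewrite -[lambda R C w]addr0; apply: cvgD; first exact: lambda_cvg.
apply: (@cvg_cesaro_bounded _ _ 1) => N.
have [c0 _] := conv_power_distribution N mud; have [m0 _] := mud.
have := distribution_le1 w (conv_power_distribution N mud).
have := distribution_le1 w mud; have := c0 w; have := m0 w.
by move=> *; rewrite ler_norml; apply/andP; split; lra.
Qed.

(** * The support of [lambda] *)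

Lemma gen_semigroup_ind n d (C : 'I_d -> bsmx n) (T : pred (bsmx n)) :
  (forall i, T (C i)) -> (forall u v, T u -> T v -> T (bsmul u v)) ->
  forall w, w \in gen_semigroup C -> T w.
Proof.
move=> TC TM w /bigcapP/(_ [set u | T u]); rewrite inE; apply; apply/andP; split.
  apply/forall_inP => u; rewrite inE => Tu; apply/forall_inP => v.
  by rewrite !inE; exact: TM.
by apply/forallP => i; rewrite inE.
Qed.

Lemma gen_semigroup_gen n d (C : 'I_d -> bsmx n) i : C i \in gen_semigroup C.
Proof. by apply/bigcapP => T /andP[_ /forallP]. Qed.

Lemma gen_semigroup_mul n d (C : 'I_d -> bsmx n) u v :
  u \in gen_semigroup C -> v \in gen_semigroup C ->
  bsmul u v \in gen_semigroup C.
Proof.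
move=> /bigcapP uS /bigcapP vS; apply/bigcapP => T PT.
have /andP[/forall_inP/(_ u (uS T PT))/forall_inP] := PT.
by move=> /(_ v (vS T PT)).
Qed.

(** Stationarity in integrated form: on average over the generators, translating
    [F] on the left does not change its [lambda]-mean. *)
Lemma sum_lambda (R : realType) n d (C : 'I_d -> bsmx n) (F : bsmx n -> R) :
  (0 < d)%N ->
  \sum_i (\sum_v lambda R C v * F (bsmul (C i) v) -
          \sum_v lambda R C v * F v) = 0.
Proof.
move=> d_gt0; rewrite big_split /= sumr_const card_ord mulNrn.
have d_neq0 : d%:R != 0 :> R by rewrite pnatr_eq0 -lt0n.
apply/eqP; rewrite subr_eq0 -[eqbLHS](mulVKf d_neq0) mulr_natl.
apply/eqP; congr (_ *+ _).
have := @sum_mu1 R n d C R^o (fun u => \sum_v lambda R C v * F (bsmul u v)).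
move=> muE; apply: (etrans (esym muE)).
have convE := @sum_convolution R n R^o (mu1 R C) (lambda R C) F.
apply: esym; apply: (etrans (etrans _ convE)); apply: eq_bigr => u _.
  by rewrite lambda_stationary.
by rewrite scaler_sumr; apply: eq_bigr => v _; rewrite scalerA.
Qed.

Lemma lambda_gen_mul (R : realType) n d (C : 'I_d -> bsmx n) i v :
  (0 < d)%N -> 0 < lambda R C v -> 0 < lambda R C (bsmul (C i) v).
Proof.
move=> d_gt0 v_gt0; have [mu_ge0 _] := mu1_distribution R C d_gt0.
have [l_ge0 _] := lambda_distribution R C d_gt0.
rewrite -lambda_stationary // /convolution (bigD1 (C i)) //=.
rewrite (bigD1 v) //= -addrA ltr_wpDr //.
  rewrite addr_ge0 // !sumr_ge0 // => u _; rewrite ?sumr_ge0 ?mulr_ge0 // => *.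
  by rewrite mulr_ge0.
rewrite mulr_gt0 // divr_gt0 ?ltr0n // card_gt0; apply/set0Pn.
by exists i; rewrite inE.
Qed.

Lemma lambda_support (R : realType) n d (C : 'I_d -> bsmx n) w :
  (0 < d)%N -> w \notin gen_semigroup C -> lambda R C w = 0.
Proof.
move=> d_gt0 wS.
have mu0 u : u \notin gen_semigroup C -> mu1 R C u = 0.
  move=> uS; rewrite /mu1 (_ : [set i | _] = finset.set0) ?cards0 ?mul0r //.
  apply/setP => i; rewrite !inE; apply: contraNF uS => /eqP <-.
  exact: gen_semigroup_gen.
have c0 m u : u \notin gen_semigroup C -> conv_power (mu1 R C) m.+1 u = 0.
  elim: m u => [|m IHm] u uS; first exact: mu0.
  rewrite conv_powerSS /convolution big1 // => v _.
  rewrite big1 // => v' /eqP vv'.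
  have [vS|/mu0->] := boolP (v \in gen_semigroup C); last by rewrite mul0r.
  rewrite IHm ?mulr0 //; apply: contraNN uS => v'S.
  by rewrite -vv' gen_semigroup_mul.
have cvw := @lambda_cvg R n d C w d_gt0.
apply: (@cvg_unique _ _ _ _ _ _ cvw); first exact: norm_hausdorff.
apply: cvg_near_cst; exists 0%N => // N _.
by rewrite cesaroE big1 ?mulr0 // => m _; rewrite c0.
Qed.

Lemma ideal_mul n (S K : {set bsmx n}) u k : ideal S K ->
  u \in S -> k \in K -> (bsmul u k \in K) && (bsmul k u \in K).
Proof.
move=> /and3P[_ _ /forall_inP idK] uS kK.
by have /forall_inP/(_ k kK) := idK u uS.
Qed.

(** Translating on the left by a generator keeps the ideal inside itself, so the
    translated indicator of [K] dominates the indicator on the support of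
    [lambda]. By [sum_lambda] the means agree on average, hence the two functions
    agree on the support: a generator cannot bring a point of the support into
    [K] from outside. This passes to all products of generators, in particular
    to an element [k] of [K], and [bsmul k w] is in [K] for every [w] in the
    semigroup, which contains the support. *)
Lemma lambda_ideal (R : realType) n d (C : 'I_d -> bsmx n) K w :
  (0 < d)%N -> ideal (gen_semigroup C) K -> w \notin K -> lambda R C w = 0.
Proof.
move=> d_gt0 idK wK; have [l_ge0 _] := lambda_distribution R C d_gt0.
have lS v : 0 < lambda R C v -> v \in gen_semigroup C.
  by move=> v_gt0; apply: contraTT v_gt0 => /lambda_support-> //; rewrite ltxx.
pose F v : R := (v \in K)%:R.
have F_le i v : lambda R C v * F v <= lambda R C v * F (bsmul (C i) v).
  rewrite ler_wpM2l // ler_nat; case: (boolP (v \in K)) => // vK.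
  by have /andP[->] := ideal_mul idK (gen_semigroup_gen C i) vK.
have FE i v : lambda R C v * F (bsmul (C i) v) = lambda R C v * F v.
  have D_ge0 j : 0 <= \sum_u lambda R C u * F (bsmul (C j) u) -
                      \sum_u lambda R C u * F u.
    by rewrite subr_ge0; apply: ler_sum.
  have /(psumr_eq0P (fun j _ => D_ge0 j))/(_ i isT) := sum_lambda C F d_gt0.
  rewrite -sumrB => /(psumr_eq0P _) D0; apply/eqP.
  by rewrite -subr_eq0 D0 // => u _; rewrite subr_ge0.
(* [T u]: the support is stable under [u], and is not brought into [K] from
   outside by [u]; the first clause makes the property multiplicative. *)
pose T u := [forall v, (0 < lambda R C v) ==>
  (0 < lambda R C (bsmul u v)) && ((bsmul u v \in K) ==> (v \in K))].
have ST : forall u, u \in gen_semigroup C -> T u.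
  apply: gen_semigroup_ind => [i|u u' /forallP Tu /forallP Tu'].
    apply/forallP => v; apply/implyP => v_gt0; rewrite lambda_gen_mul //=.
    apply/implyP => ivK.
    have /(mulfI (lt0r_neq0 v_gt0)) := FE i v.
    by rewrite /F ivK; case: (v \in K) => // /eqP; rewrite oner_eq0.
  apply/forallP => v; apply/implyP => v_gt0.
  have /implyP/(_ v_gt0)/andP[u'v_gt0 /implyP Kv] := Tu' v.
  have /implyP/(_ u'v_gt0)/andP[uu'v_gt0 /implyP Ku'v] := Tu (bsmul u' v).
  by rewrite -bsmulA uu'v_gt0; apply/implyP => /Ku'v/Kv.
have /and3P[/set0Pn[k kK] /fintype.subsetP KS _] := idK.
apply/eqP; case: (ltrgtP (lambda R C w) 0) (l_ge0 w) => // w_gt0 _.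
have /forallP/(_ w)/implyP/(_ w_gt0)/andP[_ /implyP] := ST k (KS k kK).
by rewrite (negPf wK); apply; have /andP[_] := ideal_mul idK (lS w w_gt0) kK.
Qed.

(** * The limit matrix on subsets and the measure on range classes *)

(** The image of a function on [bsmx n], viewed as an element of the semigroup
    algebra, under the representation [subset_mx]. *)
Definition subset_comb (R : pzRingType) n l (p : bsmx n -> R) :
    'M[R]_#|ksubsets n l| :=
  \sum_w p w *: subset_mx R l w.

Lemma subset_combM (R : comPzRingType) n l (p q : bsmx n -> R) :
  subset_comb l (convolution p q) = subset_comb l p *m subset_comb l q.
Proof.
rewrite /subset_comb sum_convolution mulmx_suml; apply: eq_bigr => u _.
rewrite mulmx_sumr; apply: eq_bigr => v _.
by rewrite -scalemxAl -scalemxAr scalerA subset_mxM.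
Qed.

Lemma A_level_comb (R : fieldType) n d (C : 'I_d -> bsmx n) l :
  A_level R C l = subset_comb l (mu1 R C).
Proof. by rewrite /subset_comb sum_mu1. Qed.

Lemma A_level_exp (R : fieldType) n d (C : 'I_d -> bsmx n) l m :
  A_level R C l ^+ m.+1 = subset_comb l (conv_power (mu1 R C) m.+1).
Proof.
elim: m => [|m IHm]; first by rewrite expr1 A_level_comb.
rewrite exprS IHm A_level_comb; exact: esym (subset_combM _ _ _).
Qed.

Lemma A_level_cesaro (R : realType) n d (C : 'I_d -> bsmx n) l N :
  N%:R^-1 *: \sum_(1 <= m < N.+1) A_level R C l ^+ m =
  subset_comb l (cesaro (mu1 R C) N).
Proof.
rewrite big_add1 big_mkord; under eq_bigr do rewrite A_level_exp.
rewrite exchange_big scaler_sumr; apply: eq_bigr => w _ /=.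
by rewrite -scaler_suml scalerA cesaroE.
Qed.

Lemma subset_comb_cvg (R : realType) n d (C : 'I_d -> bsmx n) l a b :
  (0 < d)%N ->
  ((fun N => subset_comb l (cesaro (mu1 R C) N) a b) @ \oo -->
   subset_comb l (lambda R C) a b)%classic.
Proof.
move=> d_gt0; rewrite summxE; under eq_cvg do rewrite summxE.
apply: cvg_sumr => w; rewrite mxE; under eq_cvg do rewrite mxE.
by apply: cvgMr_tmp; exact: lambda_cvg.
Qed.

Lemma Omega_level_comb (R : realType) n d (C : 'I_d -> bsmx n) l :
  (0 < d)%N -> Omega_level R C l = subset_comb l (lambda R C).
Proof.
move=> d_gt0; apply/matrixP => a b; rewrite mxE.
under eq_fun do rewrite A_level_cesaro.
exact: (cvg_lim _ (@subset_comb_cvg R n d C l a b d_gt0)).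
Qed.

(** [lambda] is fixed by convolution with [mu1], so [A_level *m Omega = Omega];
    hence the Cesàro means of the powers of [A_level] fix [Omega], and so does
    their limit. *)
Lemma Omega_level_idem (R : realType) n d (C : 'I_d -> bsmx n) l :
  (0 < d)%N -> Omega_level R C l *m Omega_level R C l = Omega_level R C l.
Proof.
move=> d_gt0; rewrite !Omega_level_comb //; set W := subset_comb l _.
have AW : A_level R C l *m W = W.
  rewrite A_level_comb -subset_combM; apply: eq_bigr => w _.
  by rewrite lambda_stationary.
have AmW m : A_level R C l ^+ m *m W = W.
  by elim: m => [|m IHm]; rewrite ?expr0 ?mul1mx // exprS -mulmxA IHm.
have ceW N : subset_comb l (cesaro (mu1 R C) N.+1) *m W = W.
  rewrite -A_level_cesaro -scalemxAl mulmx_suml (eq_bigr (fun=> W)) //.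
  by rewrite sumr_const_nat subSS subn0 -(scaler_nat _ W) scalerA mulVf ?scale1r.
apply/matrixP => a b.
have cvW : ((fun N => (subset_comb l (cesaro (mu1 R C) N) *m W) a b) @ \oo -->
            (W *m W) a b)%classic.
  rewrite mxE; under eq_cvg do rewrite mxE.
  by apply: cvg_sumr => c; apply: cvgMr_tmp; exact: subset_comb_cvg.
apply: (@cvg_unique _ _ _ _ _ _ cvW); first exact: norm_hausdorff.
by apply: cvg_near_cst; exists 1%N => // -[//|N] _; rewrite /= ceW.
Qed.

(** If [J] is the range of [k'], the image of [J] by [k] is the range of
    [bsmul k' k], which lies in [K]; it is contained in the range of [k] and has
    the same size. *)
Lemma imset_range_class n (S K : {set bsmx n}) r k J :
  ideal S K -> (forall k, k \in K -> #|mxrange k| = r) ->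
  k \in K -> J \in range_classes K -> bsfun k @: J = mxrange k.
Proof.
move=> idK cardK kK /imsetP[k' k'K ->].
have /and3P[_ /fintype.subsetP KS _] := idK.
have /andP[k'kK _] := ideal_mul idK (KS k' k'K) kK.
apply/eqP; rewrite -mxrange_mul eqEcard !cardK // leqnn andbT mxrange_mul.
exact: imset_sub_mxrange.
Qed.

Theorem mainTheorem13 (R : realType) (n d : nat) (n_gt0 : (0 < n)%N)
    (d_gt0 : (0 < d)%N) (Adj : 'M[nat]_n) (C : 'I_d -> bsmx n)
    (Adj_deg : forall i, (\sum_j Adj i j)%N = d)
    (AdjE : Adj = \sum_i (C i : 'M[nat]_n))
    (A_irr : irreducible_mx (d%:R^-1 *: natmx R Adj))
    (A_aper : aperiodic_mx (d%:R^-1 *: natmx R Adj))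
    (K : {set bsmx n}) (K_ker : is_kernel (gen_semigroup C) K)
    (r : nat) (K_rank : forall k, k \in K -> \rank (natmx R k) = r) :
  let pi_r := pi_level R C r in
  let total := \sum_a pi_r ord0 a in
  [/\ range_classes K \subset ksubsets n r,
      (forall a, ksubset a \notin range_classes K -> pi_r ord0 a = 0),
      0 < total &
      (forall a, pi_r ord0 a / total = beta R C K (ksubset a))].
Proof.
move=> pi_r total; have idK := minsetp K_ker.
have cardK k : k \in K -> #|mxrange k| = r by move/K_rank; rewrite rank_natmx.
have [l_ge0 l_sum1] := lambda_distribution R C d_gt0.
have l0 w : w \notin K -> lambda R C w = 0 by exact: lambda_ideal.
have OmegaE a b : Omega_level R C r a b =
    \sum_(k in K) lambda R C k * (bsfun k @: ksubset a == ksubset b)%:R.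
  rewrite Omega_level_comb // summxE [RHS]big_mkcond; apply: eq_bigr => w _.
  by rewrite !mxE; case: ifPn => // /l0->; rewrite mul0r.
have Omega_ge0 a b : 0 <= Omega_level R C r a b.
  by rewrite OmegaE sumr_ge0 // => k _; rewrite mulr_ge0.
have piE b : pi_r ord0 b = \sum_a Omega_level R C r a b.
  by rewrite mxE; apply: eq_bigr => a _; rewrite mxE mul1r.
have sizeE (a : 'I_#|ksubsets n r|) : #|ksubset a| = r.
  by have := enum_valP a; rewrite inE => /eqP.
have pi_supp b : ksubset b \notin range_classes K -> pi_r ord0 b = 0.
  move=> bK; rewrite piE big1 // => a _; rewrite OmegaE big1 // => k kK.
  case: eqP => [kab|_]; last by rewrite mulr0.
  case/negP: bK; apply/imsetP; exists k => //.
  by apply/eqP; rewrite eqEcard -{1}kab imset_sub_mxrange cardK // sizeE leqnn.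
have classes_r : range_classes K \subset ksubsets n r.
  by apply/fintype.subsetP => _ /imsetP[k kK ->]; rewrite inE cardK.
have total_gt0 : 0 < total.
  have pi_ge0 b : 0 <= pi_r ord0 b by rewrite piE sumr_ge0.
  have [k kK lk_gt0] : exists2 k, k \in K & 0 < lambda R C k.
    have sum_neq0 : \sum_w lambda R C w <> 0.
      by apply/eqP; rewrite l_sum1 oner_eq0.
    have [k /= lk_gt0] := psumr_neq0P (fun w _ => l_ge0 w) sum_neq0.
    exists k => //.
    by apply: contraTT lk_gt0 => /l0->; rewrite ltxx.
  (* [k] maps its own range onto itself: a positive diagonal entry. *)
  have kr : mxrange k \in ksubsets n r by rewrite inE cardK.
  pose b := enum_rank_in kr (mxrange k).
  have bE : ksubset b = mxrange k by rewrite /ksubset enum_rankK_in.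
  rewrite /total (bigD1 b) //= ltr_wpDr ?sumr_ge0 // piE (bigD1 b) //=.
  rewrite ltr_wpDr ?sumr_ge0 // OmegaE (bigD1 k) //= bE.
  rewrite (imset_range_class idK cardK kK) ?imset_f // eqxx mulr1.
  by rewrite ltr_wpDr // sumr_ge0 // => w _; rewrite mulr_ge0.
split=> // b; have -> : pi_r ord0 b = total * beta R C K (ksubset b).
  (* Replacing [Omega] by its square gives [pi_r = pi_r *m Omega], which is
     then evaluated on the rows indexed by range classes. *)
  rewrite /pi_r /pi_level -Omega_level_idem // mulmxA mxE mulr_suml.
  apply: eq_bigr => a _; rewrite -/(pi_level R C r) -/pi_r.
  have [aK|/pi_supp->] := boolP (ksubset a \in range_classes K); last first.
    by rewrite !mul0r.
  congr (_ * _); rewrite OmegaE /beta [RHS]big_mkcondr; apply: eq_bigr => k kK.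
  rewrite (imset_range_class idK cardK kK aK).
  by case: eqP; rewrite ?mulr1 ?mulr0.
by rewrite mulrAC divff ?mul1r // lt0r_neq0.
Qed.
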